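(* Let $$B=\mathbb{Z}\left[x,y,z,x^{-1},y^{-1},z^{-1},(xyz)^{1/2}\right]$$ and let $A\subset B$ be the subring $A=\mathbb{Z}[u,v,w]$ generated by $$u=x+y+z+x^{-1}+y^{-1}+z^{-1},$$ $$v=x^{\frac12}y^{\frac12}z^{\frac12}+x^{\frac12}y^{-\frac12}z^{-\frac12}+x^{-\frac12}y^{-\frac12}z^{\frac12}+x^{-\frac12}y^{\frac12}z^{-\frac12},$$ $$w=x^{-\frac12}y^{-\frac12}z^{-\frac12}+x^{\frac12}y^{-\frac12}z^{\frac12}+x^{-\frac12}y^{\frac12}z^{\frac12}+x^{\frac12}y^{\frac12}z^{-\frac12}.$$ Then $B$ is a free module over $A$.
   Context: $B$ is regarded as a subring of the Laurent polynomial ring $\mathbb{Z}[x^{\pm 1/2},y^{\pm 1/2},z^{\pm 1/2}]$ in the independent variables $x^{1/2},y^{1/2},z^{1/2}$, with $(xyz)^{1/2}=x^{1/2}y^{1/2}z^{1/2}$. $B$ is the representation ring of the Cartan subalgebra (maximal torus) of $\mathfrak{so}_6$, and $A$ is the representation ring of $\mathfrak{so}_6$, whose generators $u,v,w$ are the characters of the standard representation and the two half-spin representations. The module structure is the one given by the inclusion of rings. *)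

(* Defs.v *)
From HB Require Import structures.
From mathcomp Require Import all_boot all_order all_algebra fraction.
From mathcomp Require Import boolp mpoly ring.

Set Implicit Arguments.
Unset Strict Implicit.
Unset Printing Implicit Defensive.

Import GRing.Theory.
Local Open Scope ring_scope.

(* The subring of F generated by s: the intersection of all subrings of F     *)
(* containing s (subrings contain 1).                                         *)
Section GeneratedSubring.
Variables (F : comNzRingType) (s : seq F).

Definition subring_gen : {pred F} :=
  fun a => `[< forall T : {pred F},
                 subring_closed T -> {subset s <= T} -> a \in T >].

Lemma subring_genP (a : F) :
  reflect (forall T : {pred F},
             subring_closed T -> {subset s <= T} -> a \in T)
          (a \in subring_gen).
Proof. exact: asboolP. Qed.

Lemma mem_subring_gen : {subset s <= subring_gen}.
Proof. by move=> a sa; apply/subring_genP => T _; apply. Qed.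

Lemma subring_gen_closed : subring_closed subring_gen.
Proof.
split=> [|a b /subring_genP sa /subring_genP sb
         |a b /subring_genP sa /subring_genP sb]; apply/subring_genP => T cT sT.
- by case: cT.
- by case: (cT) => _ + _; apply; [apply: sa | apply: sb].
- by case: (cT) => _ _; apply; [apply: sa | apply: sb].
Qed.

Lemma subring_gen_sub (T : {pred F}) :
  subring_closed T -> {subset s <= T} -> {subset subring_gen <= T}.
Proof. by move=> cT sT a /subring_genP; apply. Qed.

HB.instance Definition _ :=
  GRing.isSubringClosed.Build F subring_gen subring_gen_closed.

Record gen_subring : Type :=
  GenSubring { gsval : F; gsvalP : gsval \in subring_gen }.

HB.instance Definition _ := [isSub for gsval].
HB.instance Definition _ := [Choice of gen_subring by <:].
HB.instance Definition _ := [SubChoice_isSubComNzRing of gen_subring by <:].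

End GeneratedSubring.

Section Inclusion.
Variables (F : comNzRingType) (s t : seq F).
Hypothesis sub_st : {subset subring_gen s <= subring_gen t}.

Definition incl (a : gen_subring s) : gen_subring t :=
  GenSubring (sub_st (gsvalP a)).

Definition incl_scale (a : gen_subring s) (b : gen_subring t) :
  gen_subring t := incl a * b.

Lemma incl_scaleA a b m :
  incl_scale a (incl_scale b m) = incl_scale (a * b) m.
Proof. by apply: val_inj; exact: mulrA. Qed.

Lemma incl_scale1 : left_id 1 incl_scale.
Proof. by move=> m; apply: val_inj; exact: mul1r. Qed.

Lemma incl_scaleDr : right_distributive incl_scale +%R.
Proof. by move=> a m n; exact: mulrDr. Qed.

Lemma incl_scaleDl m : {morph incl_scale^~ m : a b / a + b}.
Proof. by move=> a b; apply: val_inj; exact: mulrDl. Qed.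

End Inclusion.

(* A basis is a linearly independent spanning family, of any cardinality.     *)
Definition lin_span (R : nzRingType) (M : lmodType R)
    (I : choiceType) (e : I -> M) : Prop :=
  forall m : M, exists (r : seq I) (c : I -> R), m = \sum_(i <- r) c i *: e i.

Definition lin_indep (R : nzRingType) (M : lmodType R)
    (I : choiceType) (e : I -> M) : Prop :=
  forall (r : seq I) (c : I -> R),
    uniq r -> \sum_(i <- r) c i *: e i = 0 -> forall i, i \in r -> c i = 0.

Definition free_module (R : nzRingType) (M : lmodType R) : Prop :=
  exists (I : choiceType) (e : I -> M), lin_span e /\ lin_indep e.
Arguments free_module R M : clear implicits.

(* Z[x^(+-1/2), y^(+-1/2), z^(+-1/2)] is realized as the subring of the field *)
(* of fractions of Z[sx, sy, sz] generated by the indeterminates sx, sy, sz   *)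
(* (standing for x^(1/2), y^(1/2), z^(1/2)) and their inverses.               *)
Definition K : fieldType := {fraction {mpoly int[3]}}.

Definition sx : K := tofrac ('X_(@Ordinal 3 0 isT) : {mpoly int[3]}).
Definition sy : K := tofrac ('X_(@Ordinal 3 1 isT) : {mpoly int[3]}).
Definition sz : K := tofrac ('X_(@Ordinal 3 2 isT) : {mpoly int[3]}).

Definition laurent_gens : seq K := [:: sx; sy; sz; sx^-1; sy^-1; sz^-1].

Definition x : K := sx ^+ 2.
Definition y : K := sy ^+ 2.
Definition z : K := sz ^+ 2.

Definition B_gens : seq K := [:: x; y; z; x^-1; y^-1; z^-1; sx * sy * sz].

Definition u : K := x + y + z + x^-1 + y^-1 + z^-1.

Definition v : K :=
  sx * sy * sz + sx * sy^-1 * sz^-1 + sx^-1 * sy^-1 * sz + sx^-1 * sy * sz^-1.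

Definition w : K :=
  sx^-1 * sy^-1 * sz^-1 + sx * sy^-1 * sz + sx^-1 * sy * sz + sx * sy * sz^-1.

Definition A_gens : seq K := [:: u; v; w].

Lemma B_gens_sub (F : fieldType) (a b c : F) (T : {pred F}) :
  a != 0 -> b != 0 -> c != 0 -> subring_closed T ->
  {subset [:: a; b; c; a^-1; b^-1; c^-1] <= T} ->
  {subset [:: a ^+ 2; b ^+ 2; c ^+ 2; (a ^+ 2)^-1; (b ^+ 2)^-1; (c ^+ 2)^-1;
              a * b * c] <= T}.
Proof.
move=> a0 b0 c0 [_ _ TM] /allP /= /and5P[Ta Tb Tc Ta' /and3P[Tb' Tc' _]].
by apply/allP => /=; rewrite !expr2 !invfM !TM.
Qed.

Lemma A_gens_sub (F : fieldType) (a b c : F) (T : {pred F}) :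
  a != 0 -> b != 0 -> c != 0 -> subring_closed T ->
  {subset [:: a ^+ 2; b ^+ 2; c ^+ 2; (a ^+ 2)^-1; (b ^+ 2)^-1; (c ^+ 2)^-1;
              a * b * c] <= T} ->
  {subset [:: a ^+ 2 + b ^+ 2 + c ^+ 2
                + (a ^+ 2)^-1 + (b ^+ 2)^-1 + (c ^+ 2)^-1;
              a * b * c + a * b^-1 * c^-1 + a^-1 * b^-1 * c + a^-1 * b * c^-1;
              a^-1 * b^-1 * c^-1 + a * b^-1 * c + a^-1 * b * c + a * b * c^-1]
     <= T}.
Proof.
move=> a0 b0 c0 [T1 TB TM] /allP /= /and5P[Tx Ty Tz Tx' /and4P[Ty' Tz' Tt _]].
have TD p q : p \in T -> q \in T -> p + q \in T.
  move=> Tp Tq; have -> : p + q = p - (1 - 1 - q) by ring.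
  by apply: (TB) => //; apply: (TB) => //; apply: TB.
have -> : a * b * c + a * b^-1 * c^-1 + a^-1 * b^-1 * c + a^-1 * b * c^-1
  = a * b * c * (1 + (b ^+ 2)^-1 * (c ^+ 2)^-1 + (a ^+ 2)^-1 * (b ^+ 2)^-1
                 + (a ^+ 2)^-1 * (c ^+ 2)^-1).
  by field; rewrite a0 b0 c0.
have -> : a^-1 * b^-1 * c^-1 + a * b^-1 * c + a^-1 * b * c + a * b * c^-1
  = a * b * c * ((a ^+ 2)^-1 * (b ^+ 2)^-1 * (c ^+ 2)^-1 + (b ^+ 2)^-1
                 + (a ^+ 2)^-1 + (c ^+ 2)^-1).
  by field; rewrite a0 b0 c0.
apply/allP => /=.
by repeat first [assumption | apply: (TD) | apply: (TM) | apply/andP; split].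
Qed.

Lemma tofracX_neq0 (i : 'I_3) : tofrac ('X_i : {mpoly int[3]}) != 0 :> K.
Proof. by rewrite tofrac_eq0 -msupp_eq0 msuppX. Qed.

Lemma B_sub_laurent : {subset subring_gen B_gens <= subring_gen laurent_gens}.
Proof.
apply: subring_gen_sub; first exact: subring_gen_closed.
by apply: B_gens_sub; [exact: tofracX_neq0..| exact: subring_gen_closed
                      | exact: mem_subring_gen].
Qed.

Lemma A_sub_B : {subset subring_gen A_gens <= subring_gen B_gens}.
Proof.
apply: subring_gen_sub; first exact: subring_gen_closed.
by apply: A_gens_sub; [exact: tofracX_neq0..| exact: subring_gen_closed
                      | exact: mem_subring_gen].
Qed.

Definition A : Type := gen_subring A_gens.
HB.instance Definition _ := GRing.ComNzRing.on A.

Definition B : Type := gen_subring B_gens.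
HB.instance Definition _ := GRing.ComNzRing.on B.

(* B is an A-module through the inclusion of A in B: a *: b is the product    *)
(* of a and b in B.                                                           *)
HB.instance Definition _ := GRing.Zmodule_isLmodule.Build A B
  (incl_scaleA A_sub_B) (incl_scale1 A_sub_B)
  (incl_scaleDr A_sub_B) (incl_scaleDl A_sub_B).

(* Main.v *)
Require Import Defs.
From HB Require Import structures.
From mathcomp Require Import all_boot all_order all_algebra fraction.
From mathcomp Require Import boolp mpoly ring.

Set Implicit Arguments.
Unset Strict Implicit.
Unset Printing Implicit Defensive.

Import GRing.Theory.
Local Open Scope ring_scope.

(* Since so_6 = sl_4, B is generated by the four weights t1, ..., t4 of the   *)
(* half-spin representation v, which satisfy t1 t2 t3 t4 = 1, and v, u, w are *)
(* their elementary symmetric functions of degree 1, 2, 3. In the tower       *)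
(* A < A[t1] < A[t1, t2] < A[t1, t2, t3] = B each weight is a root of the     *)
(* product of the X - t_j over the remaining weights, of degree 4, 3, 2. The  *)
(* transpositions of the Weyl group fix the lower ring and make these roots   *)
(* conjugate, so no relation of smaller degree exists, and the 24 monomials   *)
(* t1^i t2^j t3^k with i < 4, j < 3, k < 2 form a basis.                      *)

(** The polynomial with roots t1, ..., t4 has coefficients 1, v, u, w up to sign, so it is monic
    over A. Once a root is adjoined, its linear factor can be divided out ([prod_XsubC_adjoin]). At
    each stage, reduction modulo the monic polynomial gives spanning, and a relation of smaller
    degree would vanish at too many conjugate roots ([adjoin_basis]). Conjugacy comes from the
    substitutions of [weyl_imageP] through [subst_rel_root]. The three bases multiply by
    [basis_over_trans], and [A3E] identifies the top of the tower with B. *)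

Section Basis.
Variable F : fieldType.

(** Rings are predicates on one field and coefficients stay in [F], so towers compose without
    changing types. The equivalence makes [S'] exactly the span. *)
Definition basis_over (S S' : {pred F}) (I : finType) (e : I -> F) : Prop :=
  (forall b, b \in S' <->
     exists2 c : I -> F, (forall i, c i \in S) & b = \sum_i c i * e i) /\
  (forall c : I -> F, (forall i, c i \in S) ->
     \sum_i c i * e i = 0 -> forall i, c i = 0).

Lemma basis_over_mem (S : subringClosed F) (S' : {pred F}) (I : finType)
    (e : I -> F) :
  basis_over S S' e -> forall i, e i \in S'.
Proof.
move=> [span _] i; apply/span; exists (fun j => (j == i)%:R) => [j|].
  exact: rpred_nat.
rewrite (bigD1 i) //= eqxx mul1r big1 ?addr0 // => j /negPf ->.
by rewrite mul0r.
Qed.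

Lemma basis_over_trans (S S' S'' : {pred F}) (I J : finType)
    (e : I -> F) (f : J -> F) :
  basis_over S S' e -> basis_over S' S'' f ->
  basis_over S S'' (fun ij : I * J => e ij.1 * f ij.2).
Proof.
move=> [spanS freeS] [spanS' freeS'].
have sumE (c : I * J -> F) :
    \sum_ij c ij * (e ij.1 * f ij.2)
    = \sum_j (\sum_i c (i, j) * e i) * f j.
  rewrite (eq_bigr (fun ij => (fun i j => c (i, j) * (e i * f j)) ij.1 ij.2));
    last by case.
  rewrite -(pair_bigA _ (fun i j => c (i, j) * (e i * f j))) exchange_big /=.
  apply: eq_bigr => j _; rewrite mulr_suml.
  by apply: eq_bigr => i _; rewrite mulrA.
split=> [b|c cS].
  rewrite spanS'; split=> [[d dS' ->]|[c cS ->]].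
    have /choice[c cP] j : exists c : I -> F,
        (forall i, c i \in S) /\ d j = \sum_i c i * e i.
      by have /spanS[c cS dE] := dS' j; exists c.
    exists (fun ij => c ij.2 ij.1) => [ij|]; first exact: (cP ij.2).1.
    by rewrite sumE; apply: eq_bigr => j _; rewrite (cP j).2.
  exists (fun j => \sum_i c (i, j) * e i); last exact: sumE.
  by move=> j; apply/spanS; exists (fun i => c (i, j)).
rewrite sumE => /freeS' c0 [i j].
apply: (freeS (fun i => c (i, j))) => //; apply: c0 => k.
by apply/spanS; exists (fun i => c (i, k)).
Qed.

End Basis.

(** * Adjoining a root of a monic polynomial to a subring *)

Section Adjoin.
Variables (F : fieldType) (S : subringClosed F) (r : F).

Definition adjoin : {pred F} :=
  fun b => `[< exists2 q, q \is a polyOver S & b = q.[r] >].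

Lemma adjoinP (b : F) :
  reflect (exists2 q, q \is a polyOver S & b = q.[r]) (b \in adjoin).
Proof. exact: asboolP. Qed.

Lemma adjoin_closed : subring_closed adjoin.
Proof.
split=> [|_ _ /adjoinP[p Sp ->] /adjoinP[q Sq ->]
         |_ _ /adjoinP[p Sp ->] /adjoinP[q Sq ->]]; apply/adjoinP.
- by exists 1; rewrite ?rpred1 ?hornerC.
- by exists (p - q); rewrite ?rpredB ?hornerD ?hornerN.
- by exists (p * q); rewrite ?rpredM ?hornerM.
Qed.

HB.instance Definition _ := GRing.isSubringClosed.Build F adjoin adjoin_closed.

Lemma adjoin_sub : {subset S <= adjoin}.
Proof.
by move=> a Sa; apply/adjoinP; exists a%:P; rewrite ?polyOverC ?hornerC.
Qed.

Lemma adjoin_gen : r \in adjoin.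
Proof. by apply/adjoinP; exists 'X; rewrite ?polyOverX ?hornerX. Qed.

Lemma adjoin_min (T : {pred F}) :
  subring_closed T -> {subset S <= T} -> r \in T -> {subset adjoin <= T}.
Proof.
move=> cT ST rT b /adjoinP[q /polyOverP Sq ->].
pose TT := GRing.isSubringClosed.Build F T cT.
pose T' : subringClosed F := HB.pack T TT.
rewrite horner_coef; apply: (@rpred_sum _ T') => i _.
by apply: (@rpredM _ T'); [exact: ST | exact: (@rpredX _ T')].
Qed.

(** Since [p] is monic, division by it never leaves the subring [S]. *)
Lemma adjoin_reduce (p q : {poly F}) :
  p \is monic -> p \is a polyOver S -> root p r -> q \is a polyOver S ->
  exists q', [/\ q' \is a polyOver S, (size q' < size p)%N & q'.[r] = q.[r]].
Proof.
move=> mon_p Sp /rootP pr0.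
elim/poly_ind: q => [_|q c IHq Sqc].
  by exists 0; rewrite rpred0 size_poly0 size_poly_gt0 monic_neq0.
have /IHq[q' [Sq' ltq'p q'E]] : q \is a polyOver S.
  apply/polyOverP => i; have /polyOverP/(_ i.+1) := Sqc.
  by rewrite coefD coefMX coefC addr0.
have Sc : c \in S.
  by have /polyOverP/(_ 0%N) := Sqc; rewrite coefD coefMX coefC add0r.
(* [s] has size at most [size p], so subtracting [l *: p] removes the only coefficient in excess. *)
pose s := q' * 'X + c%:P; pose l := s`_(size p).-1.
have Ss : s \is a polyOver S by rewrite rpredD ?rpredM ?polyOverX ?polyOverC.
exists (s - l *: p); split.
- by rewrite rpredB // polyOverZ // (polyOverP Ss).
- rewrite -(prednK (leq_ltn_trans (leq0n _) ltq'p)) ltnS.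
  apply/leq_sizeP => j; rewrite leq_eqVlt => /predU1P[<-|ltj].
    by rewrite coefB coefZ -[p`_ _]/(lead_coef p) (monicP mon_p) mulr1 subrr.
  have lepj : (size p <= j)%N by rewrite -(prednK (leq_ltn_trans _ ltq'p)).
  rewrite coefB coefZ (nth_default _ lepj) mulr0 subr0 nth_default //.
  apply: leq_trans lepj; by rewrite size_MXaddC; case: ifP.
- by rewrite !hornerE pr0 mulr0 subr0 q'E.
Qed.

(* Conjugacy of the roots over S stands in for irreducibility of their        *)
(* polynomial: a relation of degree < size rs would have size rs roots.       *)
Lemma adjoin_basis (rs : seq F) :
  uniq rs -> r \in rs -> \prod_(a <- rs) ('X - a%:P) \is a polyOver S ->
  (forall q a, q \is a polyOver S -> q.[r] = 0 -> a \in rs -> q.[a] = 0) ->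
  basis_over S adjoin (fun i : 'I_(size rs) => r ^+ i).
Proof.
move=> urs rs_r Sp conj; set p := \prod_(a <- rs) _ in Sp.
have sum_poly (c : 'I_(size rs) -> F) : (forall i, c i \in S) ->
    exists q : {poly F}, [/\ q \is a polyOver S, (size q <= size rs)%N,
      forall i : 'I_(size rs), q`_i = c i & q.[r] = \sum_i c i * r ^+ i].
  move=> cS; pose d i := if insub i is Some j then c j else 0.
  have dE (i : 'I_(size rs)) : d i = c i by rewrite /d valK.
  exists (\poly_(i < size rs) d i); split.
  - apply/polyOverP => i; rewrite coef_poly; case: ifP => [lti|_]; last first.
      exact: rpred0.
    by rewrite (dE (Ordinal lti)).
  - exact: size_poly.
  - by move=> i; rewrite coef_poly ltn_ord dE.
  - by rewrite horner_poly; apply: eq_bigr => i _; rewrite dE.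
split=> [b|c /sum_poly[q [Sq szq qc <-]] q0 i].
  split=> [/adjoinP[q Sq ->]|[c /sum_poly[q [Sq _ _ <-]] ->]]; last first.
    by apply/adjoinP; exists q.
  have [||q' [Sq' ltq' <-]] := adjoin_reduce _ Sp _ Sq.
  - exact: monic_prod_XsubC.
  - by rewrite root_prod_XsubC.
  exists (fun i : 'I_(size rs) => q'`_i) => [i|]; first exact: (polyOverP Sq').
  by apply: horner_coef_wide; rewrite size_prod_XsubC in ltq'.
(* By conjugacy [q] vanishes at all the distinct elements of [rs], at least as many as its size, so
   it is zero. *)
rewrite -qc (@roots_geq_poly_eq0 _ q rs) ?coef0 //.
by apply/allP => a rs_a; apply/rootP; apply: conj rs_a.
Qed.

End Adjoin.

Lemma prod_XsubC_adjoin (F : fieldType) (S : subringClosed F) (a : F)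
    (rs : seq F) :
  \prod_(b <- a :: rs) ('X - b%:P) \is a polyOver S ->
  \prod_(b <- rs) ('X - b%:P) \is a polyOver (adjoin S a).
Proof.
rewrite big_cons; set q := \prod_(b <- rs) _ => /polyOverP Sp.
(* Downward induction on the index: [k] bounds the distance from [i] to [size q], beyond which
   coefficients vanish. *)
apply/polyOverP => i; move: {2}(size q) (leq_addl i (size q)) => k.
elim: k i => [|k IHk] i leqk.
  by rewrite nth_default ?rpred0 // -(addn0 i).
have -> : q`_i = (('X - a%:P) * q)`_i.+1 + a * q`_i.+1.
  by rewrite mulrBl coefB coefXM coefCM subrK.
by rewrite rpredD ?rpredM ?adjoin_gen ?IHk ?addSnnS // adjoin_sub.
Qed.

(** * Substitutions as partial maps on fractions *)

Section PartialMorphism.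
Variables (R : comNzRingType) (F : fieldType) (f g : {rmorphism R -> F}).

(* The partial map f P |-> g P extended to fractions, defined where the       *)
(* denominator does not vanish under g.                                       *)
Definition subst_rel (a b : F) : Prop :=
  exists P D : R, [/\ f D != 0, g D != 0, a = f P / f D & b = g P / g D].

Lemma subst_rel1 : subst_rel 1 1.
Proof. by exists 1, 1; rewrite !rmorph1 oner_neq0 divr1. Qed.

Lemma subst_rel_morph (P : R) : subst_rel (f P) (g P).
Proof. by exists P, 1; rewrite !rmorph1 !divr1 oner_neq0. Qed.

Lemma subst_relB a b a' b' :
  subst_rel a b -> subst_rel a' b' -> subst_rel (a - a') (b - b').
Proof.
move=> [P [D [F0 D0 -> ->]]] [P' [D' [F'0 D'0 -> ->]]].
exists (P * D' - P' * D), (D * D'); rewrite !(rmorphM, rmorphB) !mulf_neq0 //.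
by split=> //; field; rewrite ?F0 ?F'0 ?D0 ?D'0.
Qed.

Lemma subst_relM a b a' b' :
  subst_rel a b -> subst_rel a' b' -> subst_rel (a * a') (b * b').
Proof.
move=> [P [D [F0 D0 -> ->]]] [P' [D' [F'0 D'0 -> ->]]].
by exists (P * P'), (D * D'); rewrite !rmorphM !mulf_neq0 // !mulf_div.
Qed.

Lemma subst_relV a b : a != 0 -> b != 0 -> subst_rel a b -> subst_rel a^-1 b^-1.
Proof.
move=> a0 b0 [P [D [F0 D0 aE bE]]]; move: a0 b0; rewrite aE bE.
rewrite !mulf_eq0 !negb_or => /andP[fP0 _] /andP[gP0 _].
by exists D, P; rewrite fP0 gP0 !invf_div.
Qed.

Lemma subst_relD a b a' b' :
  subst_rel a b -> subst_rel a' b' -> subst_rel (a + a') (b + b').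
Proof.
have rel0 : subst_rel 0 0.
  by rewrite -(subrr 1); apply: subst_relB; exact: subst_rel1.
move=> ab /(subst_relB rel0) ab'.
by have := subst_relB ab ab'; rewrite !sub0r !opprK.
Qed.

Definition subst_fixed : {pred F} := fun a => `[< subst_rel a a >].

Lemma subst_fixed_closed : subring_closed subst_fixed.
Proof.
split=> [|a b /asboolP ra /asboolP rb|a b /asboolP ra /asboolP rb];
  apply/asboolP.
- exact: subst_rel1.
- exact: subst_relB.
- exact: subst_relM.
Qed.

Lemma adjoin_fixed (S : subringClosed F) (r : F) :
  {subset S <= subst_fixed} -> subst_rel r r ->
  {subset adjoin S r <= subst_fixed}.
Proof.
by move=> Sfix /asboolP rr; apply: adjoin_min => //; exact: subst_fixed_closed.
Qed.

Lemma subst_rel_horner (S : subringClosed F) (r a : F) (q : {poly F}) :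
  {subset S <= subst_fixed} -> subst_rel r a -> q \is a polyOver S ->
  subst_rel q.[r] q.[a].
Proof.
move=> Sfix ra /polyOverP Sq.
elim/poly_ind: q Sq => [|q c IHq] Sq.
  by rewrite !horner0 -(subrr 1); apply: subst_relB; exact: subst_rel1.
rewrite !hornerE; apply: subst_relD.
  apply: subst_relM => //; apply: IHq => i.
  by have := Sq i.+1; rewrite coefD coefMX coefC addr0.
by apply/asboolP/Sfix; have := Sq 0%N; rewrite coefD coefMX coefC add0r.
Qed.

Hypothesis f_inj : injective f.

(** Single-valuedness at 0 is all that conjugacy requires; a vanishing fraction has numerator 0
    because [f] is injective. *)
Lemma subst_rel0 b : subst_rel 0 b -> b = 0.
Proof.
move=> [P [D [F0 D0 /esym/eqP + ->]]].
rewrite mulf_eq0 invr_eq0 (negPf F0) orbF => /eqP fP0.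
have -> : P = 0 by apply: f_inj; rewrite fP0 rmorph0.
by rewrite rmorph0 mul0r.
Qed.

Lemma subst_rel_root (S : subringClosed F) (r a : F) (q : {poly F}) :
  {subset S <= subst_fixed} -> subst_rel r a ->
  q \is a polyOver S -> q.[r] = 0 -> q.[a] = 0.
Proof.
move=> Sfix ra Sq qr0; apply: subst_rel0; rewrite -qr0.
exact: subst_rel_horner Sfix ra Sq.
Qed.

End PartialMorphism.

(** * The four weights and their permutations *)

Section Weights.
Variable F : fieldType.
Implicit Types a b c d : F.

(* The weights of the half-spin representation v, i.e. of the standard        *)
(* representation of sl_4 = so_6.                                             *)
Definition wt1 a b c : F := a * b * c.
Definition wt2 a b c : F := a * b^-1 * c^-1.
Definition wt3 a b c : F := a^-1 * b^-1 * c.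
Definition wt4 a b c : F := a^-1 * b * c^-1.

Definition e2 a b c d : F := a * b + a * c + a * d + b * c + b * d + c * d.
Definition e3 a b c d : F := b * c * d + a * c * d + a * b * d + a * b * c.

Section Identities.
Variables a b c : F.
Hypotheses (a0 : a != 0) (b0 : b != 0) (c0 : c != 0).
Let nz := (a0, b0, c0).
Notation t1 := (wt1 a b c).
Notation t2 := (wt2 a b c).
Notation t3 := (wt3 a b c).
Notation t4 := (wt4 a b c).

Lemma wt_prod : t1 * t2 * t3 * t4 = 1.
Proof. by rewrite /wt1 /wt2 /wt3 /wt4; field; rewrite ?nz. Qed.

Lemma wt_e2 :
  a ^+ 2 + b ^+ 2 + c ^+ 2 + (a ^+ 2)^-1 + (b ^+ 2)^-1 + (c ^+ 2)^-1
  = e2 t1 t2 t3 t4.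
Proof. by rewrite /e2 /wt1 /wt2 /wt3 /wt4; field; rewrite ?nz. Qed.

Lemma wt_e3 :
  a^-1 * b^-1 * c^-1 + a * b^-1 * c + a^-1 * b * c + a * b * c^-1
  = e3 t1 t2 t3 t4.
Proof. by rewrite /e3 /wt1 /wt2 /wt3 /wt4; field; rewrite ?nz. Qed.

Lemma wt2_wt1 : t2 = t1 * (b ^+ 2)^-1 * (c ^+ 2)^-1.
Proof. by rewrite /wt1 /wt2; field; rewrite ?nz. Qed.

Lemma wt3_wt1 : t3 = t1 * (a ^+ 2)^-1 * (b ^+ 2)^-1.
Proof. by rewrite /wt1 /wt3; field; rewrite ?nz. Qed.

(** Each generator of B is a weight or a product of two weights. Inverting such a product gives the
    complementary pair, as all four weights multiply to 1. *)
Lemma squares_wt :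
  [:: a ^+ 2; b ^+ 2; c ^+ 2; (a ^+ 2)^-1; (b ^+ 2)^-1; (c ^+ 2)^-1; a * b * c]
  = [:: t1 * t2; t1 * t4; t1 * t3; t3 * t4; t2 * t3; t2 * t4; t1].
Proof.
by congr [:: _; _; _; _; _; _; _]; rewrite /wt1 /wt2 /wt3 /wt4 //; field;
  rewrite ?nz.
Qed.

(** Clearing denominators reduces distinctness of the weights to that of four monomials. *)
Lemma wt_scaled : let m := a * b * c in
  [/\ m * t1 = a ^+ 2 * b ^+ 2 * c ^+ 2, m * t2 = a ^+ 2, m * t3 = c ^+ 2
    & m * t4 = b ^+ 2].
Proof. by split; rewrite /wt1 /wt2 /wt3 /wt4; field; rewrite ?nz. Qed.

Lemma wt_swap12 : [/\ wt1 a c^-1 b^-1 = t2, wt2 a c^-1 b^-1 = t1,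
  wt3 a c^-1 b^-1 = t3 & wt4 a c^-1 b^-1 = t4].
Proof. by split; rewrite /wt1 /wt2 /wt3 /wt4 ?invrK; ring. Qed.

Lemma wt_swap13 : [/\ wt1 b^-1 a^-1 c = t3, wt2 b^-1 a^-1 c = t2,
  wt3 b^-1 a^-1 c = t1 & wt4 b^-1 a^-1 c = t4].
Proof. by split; rewrite /wt1 /wt2 /wt3 /wt4 ?invrK; ring. Qed.

Lemma wt_swap14 : [/\ wt1 c^-1 b a^-1 = t4, wt2 c^-1 b a^-1 = t2,
  wt3 c^-1 b a^-1 = t3 & wt4 c^-1 b a^-1 = t1].
Proof. by split; rewrite /wt1 /wt2 /wt3 /wt4 ?invrK; ring. Qed.

Lemma wt_swap23 : [/\ wt1 c b a = t1, wt2 c b a = t3, wt3 c b a = t2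
  & wt4 c b a = t4].
Proof. by split; rewrite /wt1 /wt2 /wt3 /wt4; ring. Qed.

Lemma wt_swap24 : [/\ wt1 b a c = t1, wt2 b a c = t4, wt3 b a c = t3
  & wt4 b a c = t2].
Proof. by split; rewrite /wt1 /wt2 /wt3 /wt4; ring. Qed.

Lemma wt_swap34 : [/\ wt1 a c b = t1, wt2 a c b = t2, wt3 a c b = t4
  & wt4 a c b = t3].
Proof. by split; rewrite /wt1 /wt2 /wt3 /wt4; ring. Qed.

End Identities.

Lemma prod4_XsubC a b c d :
  \prod_(t <- [:: a; b; c; d]) ('X - t%:P)
  = 'X ^+ 4 - (a + b + c + d)%:P * 'X ^+ 3 + (e2 a b c d)%:P * 'X ^+ 2
    - (e3 a b c d)%:P * 'X + (a * b * c * d)%:P.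
Proof. by rewrite !big_cons big_nil /e2 /e3; ring. Qed.

(** These are coefficients, up to sign, of the product of the X - t, which ignores the order of the
    roots. *)
Lemma e_perm a b c d a' b' c' d' :
  perm_eq [:: a'; b'; c'; d'] [:: a; b; c; d] ->
  [/\ a' + b' + c' + d' = a + b + c + d, e2 a' b' c' d' = e2 a b c d
    & e3 a' b' c' d' = e3 a b c d].
Proof.
move=> eq_ts.
have := perm_big _ eq_ts : \prod_(t <- _) ('X - t%:P) = \prod_(t <- _) _.
rewrite !prod4_XsubC => /polyP coefP.
have coef i := coefP i; move: (coef 3%N) (coef 2%N) (coef 1%N).
rewrite !(coefD, coefN, coefCM, coefXn, coefX, coefC) /=.
rewrite !(mulr0, mulr1, add0r, addr0, subr0, oppr0).
by move=> /oppr_inj + + /oppr_inj.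
Qed.

End Weights.

Section WeightSubstitution.
Variables (R : comNzRingType) (F : fieldType) (f g : {rmorphism R -> F}).
Variables p q r a b c : F.
Hypotheses (p0 : p != 0) (q0 : q != 0) (r0 : r != 0).
Hypotheses (a0 : a != 0) (b0 : b != 0) (c0 : c != 0).
Notation rel := (subst_rel f g).
Hypotheses (rp : rel p a) (rq : rel q b) (rr : rel r c).

Let rp' : rel p^-1 a^-1. Proof. exact: subst_relV. Qed.
Let rq' : rel q^-1 b^-1. Proof. exact: subst_relV. Qed.
Let rr' : rel r^-1 c^-1. Proof. exact: subst_relV. Qed.

Lemma subst_weights :
  [/\ rel (wt1 p q r) (wt1 a b c), rel (wt2 p q r) (wt2 a b c),
      rel (wt3 p q r) (wt3 a b c) & rel (wt4 p q r) (wt4 a b c)].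
Proof. by split; do !apply: subst_relM. Qed.

End WeightSubstitution.

Lemma subst_symmetric (R : comNzRingType) (F : fieldType)
    (f g : {rmorphism R -> F}) (T1 T2 T3 T4 T1' T2' T3' T4' : F) :
  subst_rel f g T1 T1' -> subst_rel f g T2 T2' ->
  subst_rel f g T3 T3' -> subst_rel f g T4 T4' ->
  perm_eq [:: T1'; T2'; T3'; T4'] [:: T1; T2; T3; T4] ->
  [/\ T1 + T2 + T3 + T4 \in subst_fixed f g,
      e2 T1 T2 T3 T4 \in subst_fixed f g & e3 T1 T2 T3 T4 \in subst_fixed f g].
Proof.
move=> r1 r2 r3 r4 /e_perm[E1 E2 E3].
split; apply/asboolP; [rewrite -{2}E1 | rewrite -{2}E2 | rewrite -{2}E3].
- by do !apply: subst_relD.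
- by do ![apply: subst_relD | apply: subst_relM].
- by do ![apply: subst_relD | apply: subst_relM].
Qed.

(** * The tower from A to B *)

(* R is the polynomial ring Z[sx, sy, sz] and F its fraction field; only the  *)
(* existence of substitutions is used.                                        *)
Section WeightTower.
Variables (R : comNzRingType) (F : fieldType) (f : {rmorphism R -> F}).
Variables X Y Z : R.
Hypothesis f_inj : injective f.
Hypothesis substitution : forall a b c : F,
  exists g : {rmorphism R -> F}, [/\ g X = a, g Y = b & g Z = c].
Hypothesis squares_uniq :
  uniq [:: X ^+ 2 * Y ^+ 2 * Z ^+ 2; X ^+ 2; Z ^+ 2; Y ^+ 2].

Let p := f X.
Let q := f Y.
Let r := f Z.
Hypotheses (p0 : p != 0) (q0 : q != 0) (r0 : r != 0).
Let nz := (p0, q0, r0).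

Notation t1 := (wt1 p q r).
Notation t2 := (wt2 p q r).
Notation t3 := (wt3 p q r).
Notation t4 := (wt4 p q r).

Let symmetric_gens : seq F :=
  [:: p ^+ 2 + q ^+ 2 + r ^+ 2 + (p ^+ 2)^-1 + (q ^+ 2)^-1 + (r ^+ 2)^-1;
      p * q * r + p * q^-1 * r^-1 + p^-1 * q^-1 * r + p^-1 * q * r^-1;
      p^-1 * q^-1 * r^-1 + p * q^-1 * r + p^-1 * q * r + p * q * r^-1].
Let torus_gens : seq F :=
  [:: p ^+ 2; q ^+ 2; r ^+ 2; (p ^+ 2)^-1; (q ^+ 2)^-1; (r ^+ 2)^-1; p * q * r].
Notation A0 := (subring_gen symmetric_gens).

Let symmetric_gensE :
  symmetric_gens = [:: e2 t1 t2 t3 t4; t1 + t2 + t3 + t4; e3 t1 t2 t3 t4].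
Proof. by rewrite -wt_e2 ?nz // -wt_e3 ?nz. Qed.

Definition weyl_image (T1 T2 T3 T4 : F) : Prop :=
  exists g : {rmorphism R -> F}, {subset A0 <= subst_fixed f g} /\
    [/\ subst_rel f g t1 T1, subst_rel f g t2 T2,
        subst_rel f g t3 T3 & subst_rel f g t4 T4].

(** The generators of [A0] are symmetric in the weights, so a substitution that permutes the weights
    fixes [A0]. *)
Lemma weyl_imageP (a b c T1 T2 T3 T4 : F) :
  a != 0 -> b != 0 -> c != 0 ->
  [/\ wt1 a b c = T1, wt2 a b c = T2, wt3 a b c = T3 & wt4 a b c = T4] ->
  perm_eq [:: T1; T2; T3; T4] [:: t1; t2; t3; t4] ->
  weyl_image T1 T2 T3 T4.
Proof.
move=> a0 b0 c0 [<- <- <- <-] eqT; have [g [gX gY gZ]] := substitution a b c.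
have [||| r1 r2 r3 r4] := @subst_weights _ _ f g _ _ _ _ _ _ p0 q0 r0 a0 b0 c0.
- by rewrite -gX; exact: subst_rel_morph.
- by rewrite -gY; exact: subst_rel_morph.
- by rewrite -gZ; exact: subst_rel_morph.
have [Fv Fu Fw] := subst_symmetric r1 r2 r3 r4 eqT.
exists g; split; last by split.
apply: subring_gen_sub; first exact: subst_fixed_closed.
by rewrite symmetric_gensE; apply/allP; rewrite /= Fv Fu Fw.
Qed.

(* The transpositions of the weights come from permutations of p, q, r        *)
(* composed with an even number of inversions.                                *)
Lemma weyl_image12 : weyl_image t2 t1 t3 t4.
Proof.
apply: (@weyl_imageP p r^-1 q^-1); rewrite ?invr_eq0 ?nz //.
  by apply: wt_swap12.
(* [permP] turns the permutation into an equality of counts, a commutative sum of natural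
   numbers. *)
by apply/permP => P /=; ring.
Qed.

Lemma weyl_image13 : weyl_image t3 t2 t1 t4.
Proof.
apply: (@weyl_imageP q^-1 p^-1 r); rewrite ?invr_eq0 ?nz //.
  by apply: wt_swap13.
by apply/permP => P /=; ring.
Qed.

Lemma weyl_image14 : weyl_image t4 t2 t3 t1.
Proof.
apply: (@weyl_imageP r^-1 q p^-1); rewrite ?invr_eq0 ?nz //.
  by apply: wt_swap14.
by apply/permP => P /=; ring.
Qed.

Lemma weyl_image23 : weyl_image t1 t3 t2 t4.
Proof.
apply: (@weyl_imageP r q p); rewrite ?invr_eq0 ?nz //.
  by apply: wt_swap23.
by apply/permP => P /=; ring.
Qed.

Lemma weyl_image24 : weyl_image t1 t4 t3 t2.
Proof.
apply: (@weyl_imageP q p r); rewrite ?invr_eq0 ?nz //.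
  by apply: wt_swap24.
by apply/permP => P /=; ring.
Qed.

Lemma weyl_image34 : weyl_image t1 t2 t4 t3.
Proof.
apply: (@weyl_imageP p r q); rewrite ?invr_eq0 ?nz //.
  by apply: wt_swap34.
by apply/permP => P /=; ring.
Qed.

Lemma weights_uniq : uniq [:: t1; t2; t3; t4].
Proof.
apply: (@map_uniq _ _ (fun t => p * q * r * t)) => /=.
have [-> -> -> ->] := wt_scaled p0 q0 r0.
by move: squares_uniq; rewrite -(map_inj_uniq f_inj) /= !(rmorphXn, rmorphM).
Qed.

Lemma prod_weights_polyOver :
  \prod_(t <- [:: t1; t2; t3; t4]) ('X - t%:P) \is a polyOver A0.
Proof.
rewrite prod4_XsubC wt_prod ?nz //.
have AC c : c \in [:: e2 t1 t2 t3 t4; t1 + t2 + t3 + t4; e3 t1 t2 t3 t4] ->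
    c%:P \is a polyOver A0.
  by rewrite -symmetric_gensE polyOverC; exact: mem_subring_gen.
have AX n : 'X ^+ n \is a polyOver A0 by rewrite rpredX ?polyOverX.
have ACX c n : c \in [:: e2 t1 t2 t3 t4; t1 + t2 + t3 + t4; e3 t1 t2 t3 t4] ->
    c%:P * 'X ^+ n \is a polyOver A0 by move=> /AC Ac; rewrite rpredM.
apply: rpredD; last exact: rpred1.
apply: rpredB; last by apply: (ACX _ 1); rewrite !inE eqxx ?orbT.
apply: rpredD; last by apply: ACX; rewrite !inE eqxx ?orbT.
by apply: rpredB => //; apply: ACX; rewrite !inE eqxx ?orbT.
Qed.

Notation A1 := (adjoin A0 t1).
Notation A2 := (adjoin A1 t2).
Notation A3 := (adjoin A2 t3).

Lemma A1_basis : basis_over A0 A1 (fun i : 'I_4 => t1 ^+ i).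
Proof.
apply: (@adjoin_basis _ (subring_gen symmetric_gens) t1 [:: t1; t2; t3; t4]).
- exact: weights_uniq.
- exact: mem_head.
- exact: prod_weights_polyOver.
move=> P a SP P0; rewrite !inE => /or4P[] /eqP -> //.
- by have [g [fixA []]] := weyl_image12 => rt _ _ _;
    exact: (subst_rel_root f_inj fixA rt SP P0).
- by have [g [fixA []]] := weyl_image13 => rt _ _ _;
    exact: (subst_rel_root f_inj fixA rt SP P0).
- by have [g [fixA []]] := weyl_image14 => rt _ _ _;
    exact: (subst_rel_root f_inj fixA rt SP P0).
Qed.

(** The transpositions (2 3) and (2 4) fix t1, hence all of [A1], and carry t2 to the other
    roots. *)
Lemma A2_basis : basis_over A1 A2 (fun i : 'I_3 => t2 ^+ i).
Proof.
have /andP[_ uniq3] := weights_uniq.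
apply: (@adjoin_basis _ A1 t2 [:: t2; t3; t4]) => //.
- exact: mem_head.
- exact: prod_XsubC_adjoin prod_weights_polyOver.
move=> P a SP P0; rewrite !inE => /or3P[] /eqP -> //.
- have [g [fixA [r1 rt _ _]]] := weyl_image23.
  exact: (subst_rel_root f_inj (adjoin_fixed fixA r1) rt SP P0).
- have [g [fixA [r1 rt _ _]]] := weyl_image24.
  exact: (subst_rel_root f_inj (adjoin_fixed fixA r1) rt SP P0).
Qed.

Lemma A3_basis : basis_over A2 A3 (fun i : 'I_2 => t3 ^+ i).
Proof.
have /and3P[_ _ uniq2] := weights_uniq.
apply: (@adjoin_basis _ A2 t3 [:: t3; t4]) => //.
- exact: mem_head.
- exact/prod_XsubC_adjoin/prod_XsubC_adjoin/prod_weights_polyOver.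
move=> P a SP P0; rewrite !inE => /orP[] /eqP -> //.
have [g [fixA [r1 r2 rt _]]] := weyl_image34.
exact: (subst_rel_root f_inj (adjoin_fixed (adjoin_fixed fixA r1) r2) rt SP P0).
Qed.

Lemma A3E : A3 =i subring_gen torus_gens.
Proof.
move=> b; apply/idP/idP; move: b.
  have Bg := @mem_subring_gen F torus_gens.
  have Bt : t1 \in subring_gen torus_gens by rewrite Bg // !inE eqxx !orbT.
  have [Bx' By' Bz'] : [/\ (p ^+ 2)^-1 \in subring_gen torus_gens,
      (q ^+ 2)^-1 \in subring_gen torus_gens
    & (r ^+ 2)^-1 \in subring_gen torus_gens].
    by split; apply: Bg; rewrite !inE eqxx ?orbT.
  apply: adjoin_min; first exact: subring_gen_closed.
    apply: adjoin_min; first exact: subring_gen_closed.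
      apply: adjoin_min => //; first exact: subring_gen_closed.
      apply: subring_gen_sub; first exact: subring_gen_closed.
      exact: A_gens_sub (@subring_gen_closed _ _) Bg.
    by rewrite wt2_wt1 ?nz //; do 2!apply: rpredM => //.
  by rewrite wt3_wt1 ?nz //; do 2!apply: rpredM => //.
have h1 : t1 \in A3 by do 2!apply: adjoin_sub; apply: adjoin_gen.
have h2 : t2 \in A3 by apply: adjoin_sub; apply: adjoin_gen.
have h3 : t3 \in A3 by apply: adjoin_gen.
(* The last weight need not be adjoined: it is v minus the other three. *)
have h4 : t4 \in A3.
  have -> : t4 = t1 + t2 + t3 + t4 - (t1 + t2 + t3).
    by rewrite addrAC subrr add0r.
  apply: rpredB; last by rewrite !rpredD.
  do 3!apply: adjoin_sub.
  by apply: mem_subring_gen; rewrite symmetric_gensE !inE eqxx orbT.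
apply: subring_gen_sub; first exact: adjoin_closed.
rewrite /torus_gens squares_wt ?nz //; apply/allP.
have hM s t : s \in A3 -> t \in A3 -> s * t \in A3 by exact: rpredM.
by rewrite /= h1 !(hM _ _ h1, hM _ _ h2, hM _ _ h3).
Qed.

Lemma weight_monomials_basis :
  basis_over A0 (subring_gen torus_gens)
    (fun ijk : 'I_4 * 'I_3 * 'I_2 =>
       t1 ^+ ijk.1.1 * t2 ^+ ijk.1.2 * t3 ^+ ijk.2).
Proof.
have [span free] :=
  basis_over_trans (basis_over_trans A1_basis A2_basis) A3_basis.
by split=> // b; rewrite -A3E; exact: span.
Qed.

End WeightTower.

(** * From bases inside the field to free modules *)

Lemma free_gen_subring_basis (F : fieldType) (s t : seq F)
    (st : {subset subring_gen s <= subring_gen t}) (I : finType) (e : I -> F) :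
  basis_over (subring_gen s) (subring_gen t) e ->
  exists e' : I -> gen_subring t,
    (forall b, exists c : I -> gen_subring s,
       b = \sum_i incl_scale st (c i) (e' i)) /\
    (forall c : I -> gen_subring s,
       \sum_i incl_scale st (c i) (e' i) = 0 -> forall i, c i = 0).
Proof.
move=> basis; have [span free] := basis.
exists (fun i => GenSubring (basis_over_mem basis i)); split.
  move=> [b Bb]; have /span[c Ac bE] := Bb.
  exists (fun i => GenSubring (Ac i)).
  by apply: val_inj; rewrite raddf_sum.
move=> c /(congr1 val); rewrite raddf_sum => /free c0 i.
by apply/val_inj/c0 => j; exact: gsvalP.
Qed.

Lemma free_module_finite (R : nzRingType) (M : lmodType R) (I : finType)
    (e : I -> M) :
  (forall m, exists c : I -> R, m = \sum_i c i *: e i) ->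
  (forall c : I -> R, \sum_i c i *: e i = 0 -> forall i, c i = 0) ->
  free_module R M.
Proof.
move=> span free; exists I, e; split=> [m|s c us sum0 i si].
  by have [c ->] := span m; exists (index_enum I), c.
(* Extending by 0 turns a relation on [s] into one on all of [I]. *)
pose d i := if i \in s then c i else 0.
have /free/(_ i) : \sum_j d j *: e j = 0; last by rewrite /d si.
rewrite -[RHS]sum0 [RHS]big_uniq // [RHS]big_mkcond; apply: eq_bigr => j _.
by rewrite /d; case: ifP => // _; rewrite scale0r.
Qed.

Theorem mainTheorem5 : free_module A B.
Proof.
pose X : {mpoly int[3]} := 'X_(@Ordinal 3 0 isT).
pose Y : {mpoly int[3]} := 'X_(@Ordinal 3 1 isT).
pose Z : {mpoly int[3]} := 'X_(@Ordinal 3 2 isT).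
have subst (a b c : K) :
    exists g : {rmorphism {mpoly int[3]} -> K}, [/\ g X = a, g Y = b & g Z = c].
  (* Evaluation at (a, b, c), with integer coefficients mapped into [K]. *)
  exists (mmap intr (fun i : 'I_3 => [:: a; b; c]`_i)).
  by split; rewrite [LHS]mmapX mmap1U.
have uniq_squares :
    uniq [:: X ^+ 2 * Y ^+ 2 * Z ^+ 2; X ^+ 2; Z ^+ 2; Y ^+ 2].
  (* At (2, 3, 4) the monomials take the distinct values 576, 4, 16, 9. *)
  apply: (@map_uniq _ _ (meval (fun i : 'I_3 => i.+2%:Z))).
  by rewrite /= !expr2 !mevalM !mevalXU.
have inj : injective (@tofrac {mpoly int[3]}).
  by move=> P Q /eqP; rewrite tofrac_eq => /eqP.
have basis := weight_monomials_basis inj subst uniq_squares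
  (tofracX_neq0 _) (tofracX_neq0 _) (tofracX_neq0 _).
have [e [span free]] := free_gen_subring_basis A_sub_B basis.
exact: (free_module_finite (e := e : _ -> B) span free).
Qed.
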